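(* Let $\mathcal F$ be a filter on $\omega$ which is homogeneous and isomorphic to $\mathcal F\times\omega$, and let $T_\alpha$ ($\alpha$ an ordinal) be the spaces associated with $\mathcal F$. Then $T_n$ is a countable $n$-Toronto space for every $n\le\omega$, and any subspace of $T_n$ of rank $j<n$ is homeomorphic to a topological sum of countably many copies of $T_j$.
   Context: Filters are proper. Filters $\mathcal F$ on $A$ and $\mathcal G$ on $B$ are isomorphic if some bijection $t:A\to B$ satisfies $S\in\mathcal F\iff t(S)\in\mathcal G$ for all $S\subset A$. For a filter $\mathcal F$ on $\omega$, $\mathcal F^+$ is the family of all $X\subset\omega$ meeting every $F\in\mathcal F$; $\mathcal F\restriction X=\{F\cap X:F\in\mathcal F\}$. $\mathcal F$ is homogeneous if $\mathcal F\restriction X$ is isomorphic to $\mathcal F$ for every $X\in\mathcal F^+$. $\mathcal F\times\omega$ is the filter on $\omega\times\omega$ generated by the sets $F\times\omega$, $F\in\mathcal F$. For disjoint spaces $X_n$ ($n\in\omega$), $(X_n)_{n\in\omega}\cup_{\mathcal F}\{\infty\}$ denotes the space on the set $\{\infty\}\cup\bigcup_n X_n$ in which each $X_n$ is a clopen subspace and a neighborhood base at $\infty$ consists of the sets $\{\infty\}\cup\bigcup_{n\in F}X_n$, $F\in\mathcal F$. The spaces $T_\alpha$: $T_0=\emptyset$, $T_1$ is a one-point space, $T_{\alpha+1}=(\{n\}\times T_\alpha)_{n\in\omega}\cup_{\mathcal F}\{\infty\}$, and $T_\alpha=\bigoplus_{\beta<\alpha}T_\beta$ (topological sum) for limit $\alpha$.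 For a space $X$: $X^0=X$, $X^{\alpha+1}$ is the set of non-isolated points of $X^\alpha$, $X^\alpha=\bigcap_{\beta<\alpha}X^\beta$ for limit $\alpha$. $X$ is scattered if some $X^\alpha=\emptyset$; the least such $\alpha$ is the rank $r(X)$. $X$ is $\alpha$-Toronto if it is scattered of rank $\alpha$ and homeomorphic to each of its subspaces of rank $\alpha$. ''Countably many'' means finitely many or countably infinitely many. *)

(* Defs.v *)
From HB Require Import structures.
From mathcomp Require Import all_boot.
From mathcomp Require Import all_classical topology.

Set Implicit Arguments.
Unset Strict Implicit.
Unset Printing Implicit Defensive.

Local Open Scope classical_set_scope.

Definition filter_iso (A B : Type) (F : set_system A) (G : set_system B) :=
  exists2 t : A -> B, bijective t & forall S : set A, F S <-> G (t @` S).

Definition filter_positive (T : Type) (F : set_system T) : set_system T :=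
  [set X | forall A, F A -> A `&` X !=set0].

(* [A `&` X], as a set of elements of the type [set_type X], is the preimage of
   [A] under the inclusion. *)
Definition filter_restrict (T : Type) (F : set_system T) (X : set T) :
    set_system (set_type X) :=
  [set set_val @^-1` A | A in F].

Arguments filter_restrict {T} F X.

Definition filter_homogeneous (T : Type) (F : set_system T) :=
  forall X : set T, filter_positive F X -> filter_iso (filter_restrict F X) F.

Definition filter_times_omega (F : set_system nat) : set_system (nat * nat) :=
  filter_from F (fun A => A `*` [set: nat]).

(* [None] is the point at infinity. *)
Definition filter_sum (F : pfilter_on nat) (X : nat -> topologicalType) : Type :=
  option {n & X n}.

Section filter_sum_topology.
Context {F : pfilter_on nat} {X : nat -> topologicalType}.

Local Notation FX := (filter_sum F X).

HB.instance Definition _ := Choice.on FX.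

Definition filter_sum_nbhs (z : FX) : set_system FX :=
  if z is Some p then Some @ nbhs p else
    filter_from F
      (fun A => [set None] `|` \bigcup_(n in A) range (Some \o existT X n)).

Let filter_sum_nbhs_filter (z : FX) : ProperFilter (filter_sum_nbhs z).
Proof.
case: z => [p|]; first exact: fmap_proper_filter.
apply: filter_from_proper; last by move=> A _; exists None; left.
apply: filter_from_filter; first by exists setT; exact: filterT.
move=> A B FA FB; exists (A `&` B); first exact: filterI.
move=> z [->|[n [An Bn] nz]]; first by split; left.
by split; right; exists n.
Qed.

Let filter_sum_nbhs_singleton (z : FX) U : filter_sum_nbhs z U -> U z.
Proof. by case: z => [p /= /nbhs_singleton//|[A _]]; apply; left. Qed.

Let filter_sum_nbhs_nbhs (z : FX) U :
  filter_sum_nbhs z U -> filter_sum_nbhs z (filter_sum_nbhs^~ U).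
Proof.
case: z => [p /= /nbhs_interior//|[A FA AU]].
exists A => // _ [->|[n An [x _ <-]]]; first by exists A.
suff : nbhs x [set y | U (Some (existT X n y))] by [].
by apply: filterE => y; apply: AU; right; exists n => //; exists y.
Qed.

HB.instance Definition _ := hasNbhs.Build FX filter_sum_nbhs.

HB.instance Definition _ := @Nbhs_isNbhsTopological.Build FX
  filter_sum_nbhs_filter filter_sum_nbhs_singleton filter_sum_nbhs_nbhs.

End filter_sum_topology.

(* The ordinals less than or equal to omega. *)
Variant upto_omega := Fin of nat | Omega.

Definition upto_omega_lt (a b : upto_omega) : bool :=
  match a, b with
  | Fin m, Fin n => (m < n)%N
  | Fin _, Omega => true
  | Omega, _ => false
  end.

Fixpoint toronto_fin (F : pfilter_on nat) (n : nat) : topologicalType :=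
  match n with
  | 0 => discrete_topology void
  | 1 => discrete_topology unit
  | m.+1 => filter_sum F (fun=> toronto_fin F m)
  end.

Definition toronto_space (F : pfilter_on nat) (a : upto_omega) :
    topologicalType :=
  match a with
  | Fin n => toronto_fin F n
  | Omega => {n : nat & toronto_fin F n}
  end.

Definition cb_derivative (X : topologicalType) (a : upto_omega) : set X :=
  let fin_derivative m := iter m (fun A => A `\` isolated A) [set: X] in
  match a with
  | Fin n => fin_derivative n
  | Omega => \bigcap_n fin_derivative n
  end.

Arguments cb_derivative X a : clear implicits.

(* Having rank [a] includes being scattered. *)
Definition has_rank (X : topologicalType) (a : upto_omega) :=
  cb_derivative X a = set0 /\
  forall b, upto_omega_lt b a -> cb_derivative X b <> set0.

Definition homeomorphic (X Y : topologicalType) :=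
  exists (f : X -> Y) (g : Y -> X),
    [/\ cancel f g, cancel g f, continuous f & continuous g].

Definition toronto (a : upto_omega) (X : topologicalType) :=
  has_rank X a /\
  forall S : set X, has_rank (set_type S) a -> homeomorphic X (set_type S).

(* Main.v *)
Require Import Defs.
From mathcomp Require Import all_boot.
From mathcomp Require Import all_classical topology.

(** The whole argument takes place inside one ambient space [X] and is about
its open subsets that are copies of some $T_k$.  Starting the recursion at
$T_0 = \emptyset$, every $T_{k+1}$ is a fan over $F$ whose blades are copies of
$T_k$ (for $k = 0$ the blades are empty and the fan is one point).  This
recursive shape is the predicate [toronto_piece F k]; two sets of this shape
are homeomorphic ([toronto_piece_unique]), and their rank is $k$
([toronto_piece_derivative], [toronto_piece_derivative_neq0]).  So it remains to
cut every subspace into pieces and to control the levels that occur.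

Homogeneity says that only positivity of the index set matters: a fan whose
nonempty blades are copies of $T_k$ and sit over an $F$-positive set is a
$T_{k+1}$ ([fan_homogeneous]).  If $P$ and its complement are both positive,
then $F$ is the common refinement of two copies of itself, so the blades over
$P$ and those over the complement of $P$ can be paired off and merged without
changing the filter ([fan_merge]).

Absorption: adding to a $T_k$ countably many disjoint copies of spaces $T_l$
with $l < k$ gives again a $T_k$ ([toronto_piece_absorb]).  Indeed, viewing $F$
as $F \times \omega$, the blades over one column form an infinite family that
the neighborhoods of the top point ignore; new blades can be inserted in that
column, and summands of still lower level are absorbed in its old blades by
induction.

Decomposition: let $S$ be a subspace of $T_{n+1}$.  By induction the trace of
$S$ on the $i$-th blade is a sum of pieces $A_{i,m}$ of level at most $n$.  If
$S$ misses the top point this is all.  Otherwise the $A_{i,m}$ are the blades of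
a fan over $F \times \omega$, that is, over $F$.  Take the greatest $k$ such
that the blades of level $k$ are positive.  Removing a set of blades that a
member of the filter avoids, the remaining ones have level at most $k$; merging
and absorption turn the remaining fan into a $T_{k+1}$ ([fan_top]).  So $S$ is a
sum of pieces of level at most $n$ and one more piece, of level at most $n+1$
([toronto_piece_preimage]).

The rank of a sum of pieces is the supremum of their levels.  If it is a level
$j$ that is attained, one piece of level $j$ absorbs all lower pieces, which
leaves a sum of copies of $T_j$; for $j = n+1$ there is just one such piece.  If
the levels are unbounded, keep one piece of each occurring level and let larger
pieces absorb the others.  Applied to $T_\omega$ itself, but keeping only the
levels that occur in $S$, the same regrouping gives the same sum. *)

Set Implicit Arguments.
Unset Strict Implicit.
Unset Printing Implicit Defensive.

Local Open Scope classical_set_scope.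

(** * Homogeneous filters on the natural numbers *)

Lemma filter_iso_preimage (A B : Type) (F : set_system A) (G : set_system B) :
  filter_iso F G ->
  exists2 t : A -> B, bijective t & forall S, G S <-> F (t @^-1` S).
Proof.
move=> [t [s ts st] tFG]; exists t; first by exists s.
move=> S; rewrite tFG; suff -> : t @` (t @^-1` S) = S by [].
apply/seteqP; split=> [_ [y Sy <-]//|x Sx].
by exists (s x) => /=; rewrite st.
Qed.

Lemma filter_times_omegaE (F : set_system nat) {FF : Filter F}
    (E : set (nat * nat)) :
  filter_times_omega F E <-> F [set a | forall b, E (a, b)].
Proof.
split=> [[B FB BE]|FE].
  by apply: filterS FB => a Ba b; apply: BE; split.
by exists [set a | forall b, E (a, b)] => // -[a b] [/= Eab _]; exact: Eab.
Qed.

(** Homogeneity without the type of elements of [X]: the isomorphism becomes an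
injective enumeration of [X], and [~` X `|` S] in [F] says that the trace of
[S] belongs to the restriction of [F]. *)
Lemma homogeneous_enum (F : set_system nat) {FF : Filter F} (X : set nat) :
  filter_homogeneous F -> filter_positive F X ->
  exists s : nat -> nat, [/\ injective s, forall i, X i <-> exists n, s n = i &
    forall S, F (s @^-1` S) <-> F (~` X `|` S)].
Proof.
move=> homF /homF[t [s ts st] tF]; exists (fun n => \val (s n)); split.
- by move=> m n /val_inj /(can_inj st).
- move=> i; split=> [Xi|[n <-]]; last exact: set_valP.
  by exists (t (exist _ i (mem_set Xi))); rewrite ts.
move=> S; have -> : (fun n => \val (s n)) @^-1` S =
    t @` (set_val @^-1` S : set (set_type X)).
  apply/seteqP; split=> [n /= Sn|_ [x Sx <-] /=]; last by rewrite ts.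
  by exists (s n).
split=> [/tF[B FB BS]|FS]; last first.
  apply/tF; exists (~` X `|` S) => //; apply/seteqP; split=> x /=.
    by case=> // nXx; case: nXx; exact: set_valP.
  by right.
apply: filterS FB => i Bi; have [Xi|] := pselect (X i); last by left.
right; suff : (set_val @^-1` S) (exist _ i (mem_set Xi) : set_type X) by [].
by rewrite -BS.
Qed.

(** Otherwise a singleton would be positive, and the restriction of [F] to it
would live on a set of the same size as [nat]. *)
Lemma homogeneous_free (F : set_system nat) {FF : ProperFilter F} (i : nat) :
  filter_homogeneous F -> F (~` [set i]).
Proof.
move=> homF; apply: contrapT => nF.
have Fi : filter_positive F [set i].
  move=> A FA; exists i; split=> //; apply: contrapT => nAi; apply: nF.
  by apply: filterS FA => j Aj /= ji; apply: nAi; rewrite -ji.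
have [s [s_inj sX _]] := homogeneous_enum homF Fi.
have s0 : s 0 = i by apply/sX; exists 0.
have s1 : s 1 = i by apply/sX; exists 1.
by have /s_inj : s 0 = s 1 by rewrite s0 s1.
Qed.

(** * Fans and copies of the spaces in an ambient space *)

Lemma trivIset_eq (T I : Type) (A : I -> set T) i j x :
  trivIset setT A -> A i x -> A j x -> i = j.
Proof. by move=> tA Aix Ajx; apply: tA => //; exists x. Qed.

(** As [G] is closed under supersets, the last clause is the neighborhood base
$\{p\} \cup \bigcup_{i \in E} A_i$, $E \in G$.  Only neighborhoods of [p] are
prescribed, so the blades [A i] may carry any topology, and they may be empty:
this makes a fan over a subset of [I] a fan over [I]. *)
Definition fan (I : Type) (G : set_system I) (X : topologicalType) (p : X)
    (A : I -> set X) (Z : set X) :=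
  [/\ trivIset setT A, forall i, ~ A i p, Z = p |` \bigcup_i A i &
      forall U, nbhs p U <-> U p /\ G [set i | A i `<=` U]].

Lemma fan_reindex (I J : Type) (F : set_system I) (G : set_system J)
    (X : topologicalType) (p : X) (A : J -> set X) (Z : set X) (t : I -> J) :
  bijective t -> (forall S, G S <-> F (t @^-1` S)) -> fan G p A Z ->
  fan F p (A \o t) Z.
Proof.
move=> [s ts st] tFG [tA Ap -> Ab].
split=> [i j _ _ [x [/= Ai Aj]]|i||U].
- by apply: (can_inj ts); exact: trivIset_eq Ai Aj.
- exact: Ap.
- congr (_ `|` _); apply/seteqP; split=> x [i _ Ai]; last by exists (t i).
  by exists (s i) => //=; rewrite st.
by rewrite Ab tFG.
Qed.

(** [Z] is an open copy of $T_k$ in [X].  There is no separate clause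
for [k = 1]: a fan of empty blades is an isolated point. *)
Fixpoint toronto_piece (F : set_system nat) (X : topologicalType) (k : nat)
    (Z : set X) : Prop :=
  if k is k'.+1 then
    exists p A, fan F p A Z /\ forall n, toronto_piece F k' (A n)
  else Z = set0.

Section fans_over_homogeneous_filters.
Context (F : set_system nat) {FF : ProperFilter F}.
Implicit Type X : topologicalType.

Lemma toronto_piece_nbhs X k (Z : set X) x :
  toronto_piece F k Z -> Z x -> nbhs x Z.
Proof.
elim: k Z => [Z -> //|k IH Z [p [A [[tA pA ZE Ab] TA]]]].
have AZ n : A n `<=` Z by move=> y Ay; rewrite ZE; right; exists n.
rewrite {1}ZE => -[->|[n _ Anx]]; last first.
  by apply: filterS (AZ n) _; exact: IH (TA n) Anx.
by apply/Ab; split; [rewrite ZE; left|exact: filterE].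
Qed.

Context (homF : filter_homogeneous F).

(** Reindex the blades by the enumeration of [P] that carries the trace of [F]
back to [F]. *)
Lemma fan_homogeneous X k p (A : nat -> set X) (Z : set X) (P : set nat) :
  fan F p A Z -> filter_positive F P ->
  (forall i, P i -> toronto_piece F k (A i)) ->
  (forall i, ~ P i -> A i = set0) ->
  toronto_piece F k.+1 Z.
Proof.
move=> [tA Ap ZE Ab] Ppos PA nPA.
have [s [s_inj sP sF]] := homogeneous_enum homF Ppos.
have Ps n : P (s n) by apply/sP; exists n.
exists p, (A \o s); split; last by move=> n; exact: PA.
split=> [i j _ _ [x [/= Ai Aj]]|i||U].
- exact/s_inj/(trivIset_eq tA Ai Aj).
- exact: Ap.
- rewrite ZE; congr (_ `|` _).
  apply/seteqP; split=> x [i _ Ai]; last by exists (s i).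
  have /sP[n sn] : P i by apply: contrapT => /nPA Ai0; rewrite Ai0 in Ai.
  by exists n => //=; rewrite sn.
rewrite Ab (sF [set i | A i `<=` U]).
suff <- : [set i | A i `<=` U] = ~` P `|` [set i | A i `<=` U] by [].
apply/seteqP; split=> [i|i []//]; first by right.
by move=> /nPA /= ->.
Qed.

(** [F] is determined by its traces on [P] and on the complement of [P], and
both traces are copies of [F].  Enumerating both sets along these copies, the
merged blades [A (s n) `|` A (r n)] form a fan over [F] again. *)
Lemma fan_merge X k p (A : nat -> set X) (Z : set X) (P : set nat) :
  fan F p A Z -> filter_positive F P -> filter_positive F (~` P) ->
  (forall i j, P i -> ~ P j -> toronto_piece F k (A i `|` A j)) ->
  toronto_piece F k.+1 Z.
Proof.
move=> [tA Ap ZE Ab] Ppos Qpos PA.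
have [s [s_inj sP sF]] := homogeneous_enum homF Ppos.
have [r [r_inj rP rF]] := homogeneous_enum homF Qpos.
have Ps n : P (s n) by apply/sP; exists n.
have Qr n : ~ P (r n) by apply/rP; exists n.
exists p, (fun n => A (s n) `|` A (r n)); split; last by move=> n; exact: PA.
split=> [i j _ _ [x [[Ai|Ai] [Aj|Aj]]]|i||U].
- exact/s_inj/(trivIset_eq tA Ai Aj).
- by case: (Qr j); rewrite -(trivIset_eq tA Ai Aj).
- by case: (Qr i); rewrite (trivIset_eq tA Ai Aj).
- exact/r_inj/(trivIset_eq tA Ai Aj).
- by case=> /Ap.
- rewrite ZE; congr (_ `|` _).
  apply/seteqP; split=> x [i _]; last by case=> Ax; [exists (s i)|exists (r i)].
  have [/sP[n <-]|/rP[n <-]] := pselect (P i) => Ax; exists n => //.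
    by left.
  by right.
rewrite Ab; set S := [set i | A i `<=` U].
suff -> : F [set n | A (s n) `|` A (r n) `<=` U] <-> F S by [].
have -> : [set n | A (s n) `|` A (r n) `<=` U] = s @^-1` S `&` r @^-1` S.
  by apply/seteqP; split=> n; rewrite /= subUset.
split=> [FS|FS].
  have FPS : F (~` P `|` S) by apply/sF; apply: filterS FS => n [].
  have FQS : F (~` ~` P `|` S) by apply/rF; apply: filterS FS => n [].
  by apply: filterS2 FPS FQS => n [nPn|//] [nnPn|//].
apply: filterI; [apply/sF|apply/rF];
  by apply: filterS FS => n; right.
Qed.

(** The blades outside a member of [F] are far from [p], so they split off. *)
Lemma fan_trunc X p (A : nat -> set X) (Z : set X) (E : set nat) : F E ->
  fan F p A Z ->
  fan F p (fun n => if n \in E then A n else set0) (p |` \bigcup_(n in E) A n).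
Proof.
move=> FE [tA Ap ZE Ab]; split=> [i j _ _ [x []]|i||U].
- case: ifP => // _ Ai; case: ifP => // _; exact: trivIset_eq Ai.
- by case: ifP => [_|_ []]; exact: Ap.
- congr (_ `|` _); apply/seteqP; split=> x [i].
    by move=> Ei Ai; exists i => //; rewrite mem_set.
  by move=> _; case: ifP => // /set_mem; exists i.
rewrite Ab; split=> -[Up FU]; split=> //; apply: filterS2 FE FU => i Ei /=.
  by case: ifP => // _ _ ? [].
by rewrite mem_set.
Qed.

End fans_over_homogeneous_filters.

(** * Absorption and decomposition *)

(** If level [m] is not attained on a positive set, then some member of [F]
avoids it and the bound drops to [m - 1]; at level 0 this cannot happen, because
[F] is proper. *)
Lemma positive_level (F : set_system nat) {FF : ProperFilter F}
    (l : nat -> nat) m : F [set i | l i <= m] ->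
  exists k, [/\ k <= m, filter_positive F [set i | l i = k] &
                F [set i | l i <= k]].
Proof.
elim: m => [|m IH] Fm.
  exists 0; split=> // A FA; have [i [Ai li]] := filter_ex (filterI FA Fm).
  by exists i; split=> //; apply/eqP; rewrite -leqn0.
have [Pm|/existsNP[A /not_implyP[FA nA]]] :=
  pselect (filter_positive F [set i | l i = m.+1]); first by exists m.+1.
have [|k [km Pk Fk]] := IH; last by exists k; rewrite leqW.
apply: filterS (filterI FA Fm) => i [Ai /=].
by rewrite leq_eqVlt => /orP[/eqP li|//]; case: nA; exists i.
Qed.

(** For injective [f], the set under [nbhs (f y)] is the largest one whose
preimage is contained in [V]. *)
Definition topological_embedding (Y X : topologicalType) (f : Y -> X) :=
  injective f /\
  forall y V, nbhs y V <-> nbhs (f y) [set x | forall z, f z = x -> V z].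

Section decomposition.
Context (F : set_system nat) {FF : ProperFilter F}.
Context (homF : filter_homogeneous F).
Context (isoF : filter_iso F (filter_times_omega F)).
Implicit Type X : topologicalType.

(** Induction on [k].  Write [Z] as a fan over $F \times \omega$.  Column 0 is
disjoint from a member of the filter, so its blades may be rearranged at will:
the old ones move to the even places and the sets [A i] of level [k] fill odd
places, while an [A i] of lower level joins the old blade at place [i.*2], which
absorbs it by induction.  The odd places that stay empty do no harm, since the
used places form a positive set.  The bound [k.-1], rather than [l i < k], lets
empty sets [A i] (of level 0) be added also when [k = 0]. *)
Lemma toronto_piece_absorb X k (Z : set X) (D : set nat) (A : nat -> set X)
    (l : nat -> nat) :
  toronto_piece F k Z -> trivIset D A ->
  (forall i, D i -> [/\ toronto_piece F (l i) (A i), l i <= k.-1 &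
                     Z `&` A i = set0]) ->
  toronto_piece F k (Z `|` \bigcup_(i in D) A i).
Proof.
elim: k Z D A l => [|k IH] Z D A l.
  move=> -> tA TA /=; rewrite set0U; apply: bigcup0 => i /TA[].
  by rewrite leqn0 => + /eqP li0; rewrite li0.
move=> [p [B [fanB TB]]] tA TA.
have [t tbij tF] := filter_iso_preimage isoF; have [s ts st] := tbij.
have {fanB} := fan_reindex (t := s) (Bijective st ts) _ fanB.
move=> /(_ (filter_times_omega F)) [].
  move=> S; rewrite tF /=; suff -> : t @^-1` (s @^-1` S) = S by [].
  by apply/seteqP; split=> n /=; rewrite ts.
set C := B \o s => tC Cp ZE Cb.
have ZA x i : Z x -> D i -> A i x -> False.
  by move=> Zx /TA[_ _ ZA0] Ax; have : (Z `&` A i) x by []; rewrite ZA0.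
have ZC x u : C u x -> Z x by move=> Cx; rewrite ZE; right; exists u.
have Zp : Z p by rewrite ZE; left.
(* The new places of the old blades and of the sets [A i]. *)
pose sg1 (u : nat * nat) := (u.1, if u.1 is 0 then u.2.*2 else u.2).
pose sg2 i := (0, if l i == k then i.*2.+1 else i.*2).
have sg1_inj : injective sg1.
  by move=> [[|a] b] [[|c] d] //= [] /double_inj ->.
have sg2_inj : injective sg2.
  move=> i j [] /=; case: ifP => _; case: ifP => _.
  - by move=> [] /double_inj.
  - by move=> /(congr1 odd); rewrite /= !odd_double.
  - by move=> /(congr1 odd); rewrite /= !odd_double.
  - by move=> /double_inj.
pose C' w := [set x | (exists2 u, sg1 u = w & C u x) \/
                      (exists i, [/\ sg2 i = w, D i & A i x])].
have fanC' : fan (filter_times_omega F) p C' (Z `|` \bigcup_(i in D) A i).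
  split.
  - move=> w w' _ _ [x [[[u <- Cu]|[i [<- Di Ai]]] [[v <- Cv]|[j [<- Dj Aj]]]]].
    + by rewrite (trivIset_eq tC Cu Cv).
    + by case: (ZA x j) => //; exact: ZC Cu.
    + by case: (ZA x i) => //; exact: ZC Cv.
    + by congr sg2; apply: tA => //; exists x.
  - move=> w [[u _]|[i [_ Di Ai]]]; first exact: Cp.
    exact: (ZA p i).
  - rewrite {1}ZE -setUA; congr (_ `|` _); apply/seteqP; split=> x.
      case=> [[u _ Cu]|[i Di Ai]].
        by exists (sg1 u) => //; left; exists u.
      by exists (sg2 i) => //; right; exists i.
    move=> [w _ [[u _ Cu]|[i [_ Di Ai]]]]; first by left; exists u.
    by right; exists i.
  - move=> U; rewrite Cb !filter_times_omegaE.
    have F0 : F (~` [set 0]) by exact: homogeneous_free.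
    split=> -[Up FU]; split=> //;
        apply: filterS (filterI F0 FU) => -[|a] [//= _ aU] b x.
      by case=> [[[[|c] d] // [-> ->] Cx]|[i []//]]; exact: (aU b).
    by move=> Cx; apply: (aU b); left; exists (a.+1, b).
have TC'0 b : toronto_piece F k (C' (0, b.*2)).
  have -> : C' (0, b.*2) =
      C (0, b) `|` \bigcup_(i in [set b] `&` [set i | D i /\ l i < k]) A i.
    apply/seteqP; split=> x.
      move=> [[u su Cu]|[i [+ Di Ai]]].
        by left; have <- : u = (0, b) by exact: sg1_inj.
      move=> [] /=; case: ifP => lik.
        by move=> /(congr1 odd); rewrite /= !odd_double.
      move=> /double_inj <-; right; exists i => //; split=> //; split=> //.
      by have [_ /= +] := TA i Di; rewrite leq_eqVlt lik.
    case=> [Cx|[i [-> [Di li]] Ai]]; first by left; exists (0, b).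
    by right; exists b; split=> //; rewrite /sg2 ltn_eqF.
  apply: (IH _ _ _ l); first exact: TB.
    by move=> i j [_ [Di _]] [_ [Dj _]]; exact: tA.
  move=> i [_ [Di li]]; have [TAi _ _] := TA i Di; split=> //.
    by case: (k) li.
  by rewrite -subset0 => x [/ZC Zx Ai]; case: (ZA x i).
have := fan_reindex (t := t) tbij tF fanC'.
pose P n := (exists u, sg1 u = t n) \/ (exists2 i, sg2 i = t n & D i).
move=> /(fan_homogeneous homF (P := P)); apply.
- move=> E FE; have F0 : F [set n | (t n).1 != 0].
    apply/(tF [set w | w.1 != 0])/filter_times_omegaE.
    by apply: filterS (homogeneous_free 0 homF) => a /= /eqP.
  have [n [En n0]] := filter_ex (filterI FE F0).
  exists n; split=> //; left; exists (t n); move: n0 => /=.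
  by case: (t n) => -[].
- move=> n [[[[|a] b] /= <-]|[i /= <- Di]]; first exact: TC'0.
    have -> : C' (a.+1, b) = C (a.+1, b).
      apply/seteqP; split=> x; last by left; exists (a.+1, b).
      case=> [[u su Cu]|[i []//]].
      by have <- : u = (a.+1, b) by exact: sg1_inj.
    exact: TB.
  rewrite /sg2; case: ifP => lik; last exact: TC'0.
  suff -> : C' (0, i.*2.+1) = A i.
    by have [+ _ _] := TA i Di; rewrite (eqP lik).
  apply/seteqP; split=> x; last first.
    by right; exists i; split=> //; rewrite /sg2 lik.
  move=> [[[[|a] b] // [] /(congr1 odd)]|[j [sj _ Aj]]].
    by rewrite /= !odd_double.
  by have <- : j = i by apply: sg2_inj; rewrite sj /sg2 lik.
- move=> n nP; rewrite -subset0 => x [] [u].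
    by move=> un; case: nP; left; exists u.
  by move=> [un Du _]; case: nP; right; exists u.
Qed.

Lemma toronto_piece_absorb1 X k l (Z A : set X) :
  toronto_piece F k Z -> toronto_piece F l A -> l < k -> Z `&` A = set0 ->
  toronto_piece F k (Z `|` A).
Proof.
move=> TZ TA lk ZA0; rewrite -(bigcup_set1 (fun=> A) 0).
apply: (toronto_piece_absorb (l := fun=> l)) => //.
  by move=> i j -> ->.
by move=> i _; split=> //; case: k lk {TZ}.
Qed.

(** Let [k] be the greatest level that is attained on a positive set.  Lower
blades over a positive set are merged into those of level [k]; if they do not
form a positive set, they can be cut off by the choice of [E], like the higher
ones. *)
Lemma fan_top X p (A : nat -> set X) (Z : set X) (l : nat -> nat) m :
  fan F p A Z -> (forall i, toronto_piece F (l i) (A i)) ->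
  (forall i, l i <= m) ->
  exists k E, [/\ k <= m, F E &
                  toronto_piece F k.+1 (p |` \bigcup_(i in E) A i)].
Proof.
move=> fanA TA lm; have Fm : F [set i | l i <= m] by exact: filterE.
have [k [km Pk Fk]] := positive_level Fm.
have tA : trivIset setT A by case: fanA.
have [Pl|/existsNP[B /not_implyP[FB nB]]] :=
    pselect (filter_positive F [set i | l i < k]).
  exists k, [set i | l i <= k]; split=> //.
  apply: (fan_merge homF (fan_trunc Fk fanA) Pk) => [G FG|i j li lj].
    have [i [Gi /= lik]] := Pl G FG.
    by exists i; split=> //= lk; rewrite lk ltnn in lik.
  rewrite mem_set /= ?li//; case: ifPn => [/set_mem /= lj'|_]; last first.
    by rewrite setU0 -li; exact: TA.
  apply: toronto_piece_absorb1 (TA j) _ _; first by rewrite -li; exact: TA.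
    by rewrite ltn_neqAle lj' andbT; apply/eqP.
  rewrite -subset0 => x [Ai Aj]; apply: lj.
  by rewrite -li (trivIset_eq tA Ai Aj).
pose E := [set i | l i <= k] `&` B.
have FE : F E by exact: filterI.
have lE i : E i -> l i = k.
  move=> [/=]; rewrite leq_eqVlt => /orP[/eqP//|lik Bi].
  by case: nB; exists i.
exists k, E; split=> //; apply: (fan_homogeneous homF (fan_trunc FE fanA)).
- by move=> G FG; exact: filter_ex (filterI FG FE).
- by move=> i Ei; rewrite mem_set// -(lE i)//; exact: TA.
- by move=> i nEi; rewrite memNset.
Qed.

(** The piece with index 0 is the one that contains the preimage of the top
point of [B]; it is empty if that preimage is. *)
Lemma toronto_piece_preimage (Y X : topologicalType) (f : Y -> X) k
    (B : set X) :
  topological_embedding f -> toronto_piece F k B ->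
  exists (A : nat -> set Y) (l : nat -> nat),
    [/\ trivIset setT A, f @^-1` B = \bigcup_i A i,
        forall i, toronto_piece F (l i) (A i), l 0 <= k &
        forall i, l i.+1 <= k.-1].
Proof.
move=> [f_inj f_nbhs]; elim: k B => [|k IH] B.
  move=> ->; exists (fun=> set0), (fun=> 0); split=> //.
    exact: trivIset_set0.
  by rewrite preimage_set0 bigcup0.
move=> [p [C [[tC Cp BE Cb] TC]]].
have /choice[A /choice[l Al]] : forall n, exists A : nat -> set Y,
  exists l : nat -> nat, [/\ trivIset setT A, f @^-1` C n = \bigcup_i A i,
      forall i, toronto_piece F (l i) (A i) & forall i, l i <= k].
  move=> n; have [A [l [tA CE TA l0 lS]]] := IH _ (TC n).
  exists A, l; split=> // -[//|i]; exact: leq_trans (lS i) (leq_pred k).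
have CA n x : C n (f x) <-> exists i, A n i x.
  have [_ CE _ _] := Al n; rewrite -[C n (f x)]/((f @^-1` C n) x) CE.
  by split=> [[i _ Ax]|[i Ax]]; exists i.
pose A2 w := A w.1 w.2; have tA2 : trivIset setT A2.
  move=> [a b] [c d] _ _ [x [Ax Ax']].
  have Cx : C a (f x) by apply/CA; exists b.
  have Cx' : C c (f x) by apply/CA; exists d.
  have ac := trivIset_eq tC Cx Cx'; rewrite -ac in Ax' *.
  have [tA _ _ _] := Al a.
  by have -> : b = d := trivIset_eq tA Ax Ax'.
(* The blades [A a b] form a fan over $F \times \omega$; number them along the
   isomorphism with [F]. *)
have [t tbij tF] := filter_iso_preimage isoF; have [s ts st] := tbij.
pose A' n := A2 (t n); pose l' n := l (t n).1 (t n).2.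
have TA' i : toronto_piece F (l' i) (A' i).
  by case: (Al (t i).1) => _ _ TA _; exact: TA.
have l'k i : l' i <= k by case: (Al (t i).1) => _ _ _; exact.
have tA' : trivIset setT A'.
  by move=> i j _ _ [x [Ai Aj]]; exact/(can_inj ts)/(trivIset_eq tA2 Ai Aj).
have CA' x : (\bigcup_n C n) (f x) <-> (\bigcup_n A' n) x.
  split=> [[a _ /CA[b Ax]]|[n _ A'n]]; last first.
    by exists (t n).1 => //; apply/CA; exists (t n).2.
  by exists (s (a, b)) => //; rewrite /A' st.
have [[z fz]|np] := pselect (exists z, f z = p); last first.
  exists (fun n => if n is n'.+1 then A' n' else set0).
  exists (fun n => if n is n'.+1 then l' n' else 0); split=> //=.
  - by move=> [|i] [|j] _ _ [x []]// Ai Aj; rewrite (trivIset_eq tA' Ai Aj).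
  - rewrite BE; apply/seteqP; split=> x /=.
      case=> [fx|/CA'[n _ Ax]]; first by case: np; exists x.
      by exists n.+1.
    by move=> [[|n] _ //= Ax]; right; apply/CA'; exists n.
  - by case.
have fanA : fan F z A' (f @^-1` B).
  apply: (fan_reindex (t := t) tbij tF).
  split=> //.
  - move=> [a b] Az; apply: (Cp a); rewrite -fz; by apply/CA; exists b.
  - rewrite BE; apply/seteqP; split=> x /=.
      case=> [|[a _ /CA[b Ax]]]; last by right; exists (a, b).
      by rewrite -fz => /f_inj ->; left.
    case=> [->|[[a b] _ Ax]]; first by left.
    by right; exists a => //; apply/CA; exists b.
  - move=> V; rewrite f_nbhs fz Cb filter_times_omegaE.
    split=> -[Vz FV]; split.
    + exact: Vz.
    + apply: filterS FV => a CV b x Ax.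
      by apply: (CV (f x)) => //; apply/CA; exists b.
    + by move=> y; rewrite -fz => /f_inj ->.
    + apply: filterS FV => a AV y Cy x xy; rewrite -xy in Cy.
      by have /CA[b Ax] := Cy; exact: AV Ax.
have [k' [E [k'k FE TE]]] := fan_top fanA TA' l'k.
exists (fun n => if n is n'.+1 then (if n' \in E then set0 else A' n')
                 else z |` \bigcup_(i in E) A' i).
exists (fun n => if n is n'.+1 then (if n' \in E then 0 else l' n') else k'.+1).
have [_ A'z -> _] := fanA.
split=> //.
- have Ez n x : (z |` \bigcup_(i in E) A' i) x ->
      (if n \in E then set0 else A' n) x -> False.
    case: ifPn => // nE [->|[i Ei Ai]] An; first exact: (A'z n).
    by move: nE; rewrite -(trivIset_eq tA' Ai An) mem_set.
  move=> [|i] [|j] _ _ [x [Ax Ax']] //.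
  + by case: (Ez j x).
  + by case: (Ez i x).
  + move: Ax Ax'; case: ifP => // _ Ai; case: ifP => // _ Aj.
    by rewrite (trivIset_eq tA' Ai Aj).
- apply/seteqP; split=> x.
    case=> [->|[n _ Ax]]; first by exists 0 => //; left.
    have [En|nE] := pselect (E n); first by exists 0 => //; right; exists n.
    by exists n.+1 => //; rewrite memNset.
  case=> -[|n] _ /=.
    by case=> [->|[i _ Ai]]; [left|right; exists i].
  by case: ifP => // _ Ax; right; exists n.
- by move=> [|n] //; case: ifP.
- by move=> n; case: ifP.
Qed.

End decomposition.

(** * Rank *)

Section rank.
Context (F : set_system nat) {FF : ProperFilter F}.
Implicit Type X : topologicalType.

Lemma cb_derivativeS X m x : cb_derivative X (Fin m.+1) x <->
  cb_derivative X (Fin m) x /\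
  forall V, nbhs x V -> exists y, [/\ V y, cb_derivative X (Fin m) y & y <> x].
Proof.
rewrite /cb_derivative iterS; set A := iter m _ _.
split=> -[Ax iso]; split=> //.
  move=> V Vx; apply: contrapT => nV; apply: iso; split; first exact/mem_set.
  exists V => //; apply/seteqP; split=> [y [Vy Ay]|_ ->]; last first.
    by split=> //; exact: nbhs_singleton.
  by apply: contrapT => yx; apply: nV; exists y.
move=> [_ [V Vx VA]]; have [y [Vy Ay yx]] := iso V Vx.
by apply: yx; rewrite -[y = x]/([set x] y) -VA.
Qed.

(** The $k$-th derivative misses all blades of a fan of copies of $T_k$, so that
the top point is isolated in it. *)
Lemma toronto_piece_derivative X k (A : set X) m x :
  toronto_piece F k A -> k <= m -> A x -> ~ cb_derivative X (Fin m) x.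
Proof.
elim: k m A x => [m A x ->//|k IH m A x TA0]; move: (TA0).
move=> [p [B [[tB Bp AE Bb] TB]]] km Ax.
have IHB i : k <= m -> B i x -> ~ cb_derivative X (Fin m) x.
  exact: IH (TB i).
move: Ax; rewrite {1}AE => -[xp|[i _ Bi]]; last exact: IHB (ltnW km) Bi.
case: m km {IHB} => // m km /cb_derivativeS[Dx /(_ A)[]].
  by rewrite xp; apply: toronto_piece_nbhs TA0 _; rewrite AE; left.
move=> y [+ Dy yx]; rewrite AE xp in yx * => -[//|[i _ Bi]].
exact: IH (TB i) km Bi Dy.
Qed.

(** The top point survives $k$ derivations of a fan of copies of $T_k$, because
each of its neighborhoods contains a whole blade. *)
Lemma toronto_piece_derivative_neq0 X k (A : set X) m :
  toronto_piece F k A -> m < k -> exists2 x, A x & cb_derivative X (Fin m) x.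
Proof.
elim: k m A => // k IH m A [p [B [[tB Bp AE Bb] TB]]] mk.
exists p; first by rewrite AE; left.
elim: m mk => [//|m IHm mk]; apply/cb_derivativeS.
split=> [|V /Bb[Vp FV]]; first exact/IHm/ltnW.
have [i BV] := filter_ex FV; have [y By Dy] := IH _ _ (TB i) mk.
by exists y; split=> //; [exact: BV|move=> yp; apply: (Bp i); rewrite -yp].
Qed.

Lemma cb_derivative_pieces X (I : Type) (A : I -> set X) (l : I -> nat) m :
  [set: X] = \bigcup_i A i -> (forall i, toronto_piece F (l i) (A i)) ->
  cb_derivative X (Fin m) = set0 <-> forall i, l i <= m.
Proof.
move=> XE TA; split=> [D0 i|lm].
  rewrite leqNgt; apply/negP => /(toronto_piece_derivative_neq0 (TA i))[x _].
  by rewrite D0.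
rewrite -subset0 => x Dx; have : [set: X] x by [].
by rewrite XE => -[i _ Ax]; exact: toronto_piece_derivative (TA i) (lm i) Ax Dx.
Qed.

Lemma has_rank_fin_pieces X (I : Type) (A : I -> set X) (l : I -> nat) n :
  [set: X] = \bigcup_i A i -> (forall i, toronto_piece F (l i) (A i)) ->
  has_rank X (Fin n) <-> (forall i, l i <= n) /\ (0 < n -> exists i, l i = n).
Proof.
move=> XE TA; rewrite /has_rank (cb_derivative_pieces _ XE TA).
split=> -[ln nl]; split=> //.
  case: n ln nl => // n ln nl _; apply: contrapT => nln.
  apply: (nl (Fin n)); first exact: ltnSn.
  apply/(cb_derivative_pieces _ XE TA) => i; rewrite -ltnS ltn_neqAle ln andbT.
  by apply/eqP => li; apply: nln; exists i.
case=> // b /= bn /(cb_derivative_pieces _ XE TA) lb.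
have [i li] := nl (leq_ltn_trans (leq0n _) bn).
by have := lb i; rewrite li leqNgt bn.
Qed.

Lemma has_rank_omega_pieces X (I : Type) (A : I -> set X) (l : I -> nat) :
  [set: X] = \bigcup_i A i -> (forall i, toronto_piece F (l i) (A i)) ->
  has_rank X Omega <-> forall m, exists i, m < l i.
Proof.
move=> XE TA; rewrite /has_rank; split=> [[_ nl] m|lm].
  apply: contrapT => nlm; apply: (nl (Fin m)) => //.
  apply/(cb_derivative_pieces _ XE TA) => i; rewrite leqNgt; apply/negP => li.
  by apply: nlm; exists i.
split=> [|[m|]// _ /(cb_derivative_pieces _ XE TA) lb]; last first.
  by have [i] := lm m; rewrite ltnNge lb.
rewrite -subset0 => x Dx; have : [set: X] x by [].
rewrite XE => -[i _ Ax].
exact: (toronto_piece_derivative (TA i) (leqnn _) Ax) (Dx (l i) Logic.I).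
Qed.

End rank.

(** * Gluing homeomorphisms *)

(** Partial functions as relations, so that gluing is a union and needs no
default values.  As neighborhoods in [X] are used, the domain [A] is open. *)
Definition continuous_graph (X Y : topologicalType) (R : X -> Y -> Prop)
    (A : set X) :=
  [/\ forall x y, R x y -> A x, forall x, A x -> exists y, R x y,
      forall x y y', R x y -> R x y' -> y = y' &
      forall x y U, R x y -> nbhs y U ->
        nbhs x [set x' | exists2 y', R x' y' & U y']].

Definition open_homeomorphic (X Y : topologicalType) (A : set X) (B : set Y) :=
  exists R : X -> Y -> Prop,
    continuous_graph R A /\ continuous_graph (fun y x => R x y) B.

Lemma open_homeomorphicT (X Y : topologicalType) :
  open_homeomorphic [set: X] [set: Y] -> homeomorphic X Y.
Proof.
move=> [R [[_ Rx Rfun Rcont] [_ Sy Sfun Scont]]].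
have /choice[f Rf] : forall x, exists y, R x y by move=> x; exact: Rx.
have /choice[g Rg] : forall y, exists x, R x y by move=> y; exact: Sy.
exists f, g; split=> [x|y|x U nU|y U nU].
- exact: Sfun (Rg _) (Rf _).
- exact: Rfun (Rf _) (Rg _).
- apply: filterS (Rcont _ _ _ (Rf x) nU) => x' [y' Ry Uy] /=.
  by rewrite (Rfun _ _ _ (Rf x') Ry).
- apply: filterS (Scont _ _ _ (Rg y) nU) => y' [x' Ry Ux] /=.
  by rewrite (Sfun _ _ _ (Rg y') Ry).
Qed.

Lemma continuous_graph_bigcup (X Y : topologicalType) (I : Type)
    (R : I -> X -> Y -> Prop) (A : I -> set X) :
  trivIset setT A -> (forall i, continuous_graph (R i) (A i)) ->
  continuous_graph (fun x y => exists i, R i x y) (\bigcup_i A i).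
Proof.
move=> tA RA; split.
- by move=> x y [i Rxy]; exists i => //; case: (RA i) => /(_ _ _ Rxy).
- by move=> x [i _ Ax]; have [_ /(_ _ Ax)[y Rxy] _ _] := RA i; exists y, i.
- move=> x y y' [i Rxy] [j Rxy'].
  have [/(_ _ _ Rxy) Ai _ Rfun _] := RA i.
  have [/(_ _ _ Rxy') Aj _ _ _] := RA j.
  by rewrite -(trivIset_eq tA Ai Aj) in Rxy'; exact: Rfun Rxy Rxy'.
- move=> x y U [i Rxy] nU; have [_ _ _ /(_ _ _ _ Rxy nU)] := RA i.
  by apply: filterS => x' [y' Ry Uy]; exists y' => //; exists i.
Qed.

Lemma open_homeomorphic_bigcup (X Y : topologicalType) (I : Type)
    (A : I -> set X) (B : I -> set Y) :
  trivIset setT A -> trivIset setT B ->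
  (forall i, open_homeomorphic (A i) (B i)) ->
  open_homeomorphic (\bigcup_i A i) (\bigcup_i B i).
Proof.
move=> tA tB /choice[R RAB]; exists (fun x y => exists i, R i x y).
split; apply: continuous_graph_bigcup => // i; by case: (RAB i).
Qed.

Lemma continuous_graph_fan (X Y : topologicalType) (F : set_system nat)
    {FF : Filter F} (R : nat -> X -> Y -> Prop) p q A B Z W :
  fan F p A Z -> fan F q B W ->
  (forall i, continuous_graph (R i) (A i)) ->
  (forall i x y, R i x y -> B i y) ->
  continuous_graph (fun x y => (x = p /\ y = q) \/ exists i, R i x y) Z.
Proof.
move=> [tA Ap -> Ab] [_ Bq _ Bb] RA RB.
have [RS RT Rfun Rcont] := continuous_graph_bigcup tA RA.
have Rp i y : ~ R i p y.
  by move=> Rpy; apply: (Ap i); case: (RA i) => /(_ _ _ Rpy).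
split.
- by move=> x y [[-> _]|/RS]; [left|right].
- by move=> x [->|/RT[y Rxy]]; [exists q; left|exists y; right].
- move=> x y y' [[xp ->]|Rxy] [[xp' ->]|Rxy'] //.
  + by case: Rxy' => i; rewrite xp => /Rp.
  + by case: Rxy => i; rewrite xp' => /Rp.
  + exact: Rfun Rxy Rxy'.
- move=> x y U [[-> ->]|Rxy] nU; last first.
    apply: filterS (Rcont _ _ _ Rxy nU) => x' [y' Ry Uy].
    by exists y' => //; right.
  move: nU => /Bb[Uq FU]; apply/Ab; split; first by exists q => //; left.
  apply: filterS FU => i BU x' Ax'; have [_ /(_ _ Ax')[y' Ry] _ _] := RA i.
  by exists y'; [right; exists i|exact/BU/RB/Ry].
Qed.

Lemma toronto_piece_unique (F : set_system nat) {FF : Filter F}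
    (X Y : topologicalType) k (A : set X) (B : set Y) :
  toronto_piece F k A -> toronto_piece F k B -> open_homeomorphic A B.
Proof.
elim: k A B => [A B -> ->|k IH A B [p [A' [fA TA]]] [q [B' [fB TB]]]].
  by exists (fun _ _ => False); split; split=> // x [].
have /choice[R RAB] : forall i, open_homeomorphic (A' i) (B' i).
  by move=> i; exact: IH (TA i) (TB i).
exists (fun x y => (x = p /\ y = q) \/ exists i, R i x y); split.
  apply: continuous_graph_fan fA fB _ _; first by move=> i; case: (RAB i).
  by move=> i x y Rxy; case: (RAB i) => _ [/(_ _ _ Rxy)].
have := continuous_graph_fan (R := fun i y x => R i x y) fB fA.
have -> : (fun y x => (y = q /\ x = p) \/ (exists i, R i x y)) =
          (fun y x => (x = p /\ y = q) \/ (exists i, R i x y)).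
  by apply/funext => y; apply/funext => x; rewrite (propext (and_comm _ _)).
apply; first by move=> i; case: (RAB i).
by move=> i x y Rxy; case: (RAB i) => [[/(_ _ _ Rxy)]].
Qed.

(** * Pieces in the given spaces and in their subspaces *)

Lemma toronto_piece_image (F : set_system nat) (X Y : topologicalType)
    (f : X -> Y) k (A : set X) :
  injective f -> (forall x U, nbhs (f x) U <-> nbhs x (f @^-1` U)) ->
  toronto_piece F k A -> toronto_piece F k (f @` A).
Proof.
move=> f_inj f_nbhs; elim: k A => [A ->|k IH A]; first exact: image_set0.
move=> [p [B [[tB Bp -> Bb] TB]]]; exists (f p), (fun i => f @` B i).
split; last by move=> i; exact: IH (TB i).
split=> [i j _ _ [_ [[x Bx <-] [y By /f_inj yx]]]|i [x Bx /f_inj xp]||U].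
- by rewrite yx in By; exact: trivIset_eq Bx By.
- by apply: (Bp i); rewrite -xp.
- rewrite image_setU image_set1 image_bigcup; congr (_ `|` _).
rewrite f_nbhs Bb /=; suff -> : [set i | B i `<=` f @^-1` U] =
    [set i | f @` B i `<=` U] by [].
apply/seteqP; split=> i /=; first by move=> BU _ [x Bx <-]; exact: BU.
by move=> BU x Bx; apply: BU; exists x.
Qed.

Lemma toronto_fin_piece (F : pfilter_on nat) n :
  toronto_piece F n [set: toronto_fin F n].
Proof.
elim: n => [|[_|n IH]]; first by apply/seteqP; split=> -[].
  exists tt, (fun=> set0); split=> //; split=> //.
  - exact: trivIset_set0.
  - by move=> i [].
  - by apply/seteqP; split=> -[] //; left.
  - move=> U; split=> [/nbhs_singleton Ut|[Ut _]].
      by split=> //; apply: filterE => i x [].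
    have -> : U = setT by apply/seteqP; split=> // -[].
    exact: filterT.
exists None, (fun i => range (Some \o existT (fun=> toronto_fin F n.+1) i)).
split; first split.
- by move=> i j _ _ [x [[y _ <-] [z _ [ij _]]]].
- by move=> i [].
- apply/seteqP; split=> // -[[i x]|] _; last by left.
  by right; exists i => //; exists x.
- move=> U; split=> [[A FA AU]|[UN FU]].
    split; first by apply: AU; left.
    by apply: filterS FA => i Ai x Rx; apply: AU; right; exists i.
  exists [set i |
      range (Some \o existT (fun=> toronto_fin F n.+1) i) `<=` U] => //.
  by move=> x [->//|[i /= iU]]; exact: iU.
- by move=> i; apply: toronto_piece_image IH => // x y [].
Qed.

Lemma set_val_embedding (X : topologicalType) (S : set X) :
  topological_embedding (set_val : set_type S -> X).
Proof.
split=> [x y /val_inj//|x V]; split.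
  rewrite nbhsE => -[_ [[W oW <-] Wx] WV].
  rewrite nbhsE; exists W => // y Wy z zy; apply: (WV z).
  by rewrite /= zy.
move=> nV; pose W := [set y | forall z : set_type S, set_val z = y -> V z].
have : nbhs x (set_val @^-1` W) by exact: initial_continuous nV.
by apply: filterS => y; exact.
Qed.

Lemma toronto_sigma_piece (F : pfilter_on nat) (I : choiceType)
    (l : I -> nat) i :
  toronto_piece F (l i) (range (existT (fun i => toronto_fin F (l i)) i)).
Proof.
apply: toronto_piece_image (toronto_fin_piece F (l i)) => // x y.
exact: existT_inj2.
Qed.

Lemma trivIset_range_existT (I : eqType) (T : I -> Type) :
  trivIset setT (fun i => range (existT T i)).
Proof.
by move=> i j _ _ [_ [[x _ <-] [y _ yx]]]; exact: esym (existT_inj1 yx).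
Qed.

Lemma bigcup_range_existT (I : Type) (T : I -> Type) :
  [set: {i & T i}] = \bigcup_i range (existT T i).
Proof. by apply/seteqP; split=> // -[i x] _; exists i => //; exists x. Qed.

Lemma toronto_piece_countable (F : set_system nat) (X : topologicalType) k
    (A : set X) : toronto_piece F k A -> countable A.
Proof.
elim: k A => [A ->|k IH A [p [B [[_ _ -> _] TB]]]]; first exact: countable0.
rewrite -bigcup2E; apply: bigcup_countable => // -[_|[_|//]].
  exact: countable1.
by apply: bigcup_countable => // i _; exact: IH (TB i).
Qed.

(** * Sums of pieces *)

Section sums_of_pieces.
Context (F : pfilter_on nat).
Context (homF : filter_homogeneous F).
Context (isoF : filter_iso F (filter_times_omega F)).
Implicit Type X : topologicalType.

(** Absorption at each index [d] of [D], applied to the indices outside [D] that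
[phi] sends to [d]. *)
Lemma toronto_piece_regroup X (A : nat -> set X) (l : nat -> nat)
    (D : set nat) (phi : nat -> nat) :
  trivIset setT A -> (forall i, toronto_piece F (l i) (A i)) ->
  (forall i, ~ D i -> D (phi i) /\ l i <= (l (phi i)).-1) ->
  exists B : nat -> set X,
    [/\ trivIset D B, \bigcup_(d in D) B d = \bigcup_i A i &
        forall d, D d -> toronto_piece F (l d) (B d)].
Proof.
move=> tA TA phiD; pose E d := ~` D `&` [set i | phi i = d].
exists (fun d => A d `|` \bigcup_(i in E d) A i); split.
- move=> c d Dc Dd [x [[Ax|[i [nDi ic] Ax]] [Ax'|[j [nDj jd] Ax']]]].
  + exact: trivIset_eq Ax Ax'.
  + by case: nDj; rewrite -(trivIset_eq tA Ax Ax').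
  + by case: nDi; rewrite (trivIset_eq tA Ax Ax').
  + by rewrite -ic -jd (trivIset_eq tA Ax Ax').
- apply/seteqP; split=> x.
    by move=> [d Dd [Ax|[i _ Ax]]]; [exists d|exists i].
  move=> [i _ Ax]; have [Di|nDi] := pselect (D i).
    by exists i => //; left.
  by exists (phi i); [case: (phiD i nDi)|right; exists i].
- move=> d Dd; apply: (toronto_piece_absorb homF isoF (l := l)) => //.
    by move=> i j _ _; exact: tA.
  move=> i [nDi <-]; split=> //; first by case: (phiD i nDi).
  rewrite -subset0 => x [Ax Ax']; apply: (nDi).
  by rewrite -(trivIset_eq tA Ax Ax'); case: (phiD i nDi).
Qed.

Lemma homeomorphic_pieces X (I : choiceType) (A : I -> set X) (l : I -> nat) :
  trivIset setT A -> [set: X] = \bigcup_i A i ->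
  (forall i, toronto_piece F (l i) (A i)) ->
  homeomorphic X {i : I & toronto_fin F (l i)}.
Proof.
move=> tA XE TA; apply: open_homeomorphicT.
rewrite XE bigcup_range_existT; apply: open_homeomorphic_bigcup => //.
  exact: trivIset_range_existT.
by move=> i; apply: toronto_piece_unique (TA i) (toronto_sigma_piece _ _ _).
Qed.

Lemma trivIset_set_val (T I : Type) (D : set I) (A : I -> set T) :
  trivIset D A -> trivIset setT (fun i : set_type D => A (set_val i)).
Proof.
move=> tA i j _ _ Aij; apply: val_inj; apply: tA Aij; exact: set_valP.
Qed.

(** Level [j] is attained, and any one piece of level [j] absorbs all lower
ones. *)
Lemma homeomorphic_pieces_fin X (A : nat -> set X) (l : nat -> nat) j :
  trivIset setT A -> [set: X] = \bigcup_i A i ->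
  (forall i, toronto_piece F (l i) (A i)) -> has_rank X (Fin j) ->
  exists I : countType, homeomorphic X {i : I & toronto_fin F j}.
Proof.
move=> tA XE TA /(has_rank_fin_pieces _ XE TA)[lj jl].
have [w lw] : exists w, l w = j.
  case: j lj jl => [lj _|j _]; last exact.
  by exists 0; apply/eqP; rewrite -leqn0.
have [i nli|B [tB BE TB]] :=
    toronto_piece_regroup (D := [set i | l i = j]) (phi := fun=> w) tA TA.
  split=> //; rewrite lw; have := lj i; rewrite leq_eqVlt => /orP[/eqP//|].
  by case: (j).
exists (set_type [set i | l i = j]).
apply: (homeomorphic_pieces (l := fun=> j) (trivIset_set_val tB)).
  by rewrite -bigcup_set_type BE.
by move=> i; rewrite -{1}(set_valP i); exact: TB (set_valP i).
Qed.

Lemma toronto_fin_subspace n (S : set (toronto_fin F n)) :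
  exists (A : nat -> set (set_type S)) (l : nat -> nat),
    [/\ trivIset setT A, [set: set_type S] = \bigcup_i A i,
        forall i, toronto_piece F (l i) (A i), l 0 <= n &
        forall i, l i.+1 <= n.-1].
Proof.
rewrite -(preimage_setT (set_val : set_type S -> _)).
apply: (toronto_piece_preimage homF isoF (set_val_embedding S)).
exact: toronto_fin_piece.
Qed.

Lemma toronto_omega_subspace (S : set {n : nat & toronto_fin F n}) :
  exists (A : nat -> set (set_type S)) (l : nat -> nat),
    [/\ trivIset setT A, [set: set_type S] = \bigcup_i A i &
        forall i, toronto_piece F (l i) (A i)].
Proof.
pose C n := range (existT (toronto_fin F) n).
have /choice[A /choice[l Al]] : forall n,
    exists (A : nat -> set (set_type S)) (l : nat -> nat),
    [/\ trivIset setT A, set_val @^-1` C n = \bigcup_i A i &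
        forall i, toronto_piece F (l i) (A i)].
  move=> n; have [A [l [tA AE TA _ _]]] := toronto_piece_preimage homF isoF
    (set_val_embedding S) (toronto_sigma_piece F id n).
  by exists A, l.
have CA n x i : A n i x -> C n (set_val x).
  have [_ CE _] := Al n; move=> Ax.
  by rewrite -[C n _]/((set_val @^-1` C n) x) CE; exists i.
have [t [s ts st] _] := isoF.
exists (fun i => A (t i).1 (t i).2), (fun i => l (t i).1 (t i).2); split.
- move=> i j _ _ [x [Ai Aj]]; apply: (can_inj ts).
  have ij := trivIset_eq (@trivIset_range_existT _ _)
    (CA _ _ _ Ai) (CA _ _ _ Aj).
  rewrite (surjective_pairing (t i)) (surjective_pairing (t j)) -ij in Aj *.
  by have [tA _ _] := Al (t i).1; rewrite (trivIset_eq tA Ai Aj).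
- apply/seteqP; split=> // x _.
  have [n _ Cx] : (\bigcup_n C n) (set_val x) by rewrite -bigcup_range_existT.
  have [_ CE _] := Al n; have : (set_val @^-1` C n) x by [].
  by rewrite CE => -[i _ Ax]; exists (s (n, i)) => //; rewrite st.
- by move=> i; case: (Al (t i).1) => _ _; exact.
Qed.

(** If [n > 0], only the piece with index 0 can have level [n], and it absorbs
the others. *)
Lemma toronto_fin_toronto n : toronto (Fin n) (toronto_fin F n).
Proof.
have Tn := toronto_fin_piece F n.
split.
  have TE : [set: toronto_fin F n] = \bigcup_(i : unit) setT.
    by apply/seteqP; split=> // x _; exists tt.
  by apply/(has_rank_fin_pieces _ TE (fun=> Tn)); split=> // _; exists tt.
move=> S; have [A [l [tA SE TA l0 lS]]] := toronto_fin_subspace S.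
move=> /(has_rank_fin_pieces _ SE TA)[_ nl].
have l0n : l 0 = n.
  case: n S A l Tn tA SE TA l0 lS nl => [|n] S A l Tn tA SE TA l0 lS nl.
    by apply/eqP; rewrite -leqn0.
  have [//|[//|i] li] := nl; by have := lS i; rewrite li ltnn.
have [|B [tB BE TB]] :=
    toronto_piece_regroup (D := [set 0]) (phi := fun=> 0) tA TA.
  by move=> [/(_ erefl)//|i _]; rewrite l0n; split=> //; exact: lS.
apply: open_homeomorphicT; apply: toronto_piece_unique Tn _.
by rewrite SE -BE bigcup_set1; have := TB 0 erefl; rewrite l0n.
Qed.

(** Both spaces are regrouped to a sum with one piece for each level that occurs
in the subspace. *)
Lemma toronto_omega_toronto : toronto Omega {n : nat & toronto_fin F n}.
Proof.
pose C n := range (existT (toronto_fin F) n).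
have TC n : toronto_piece F n (C n) := toronto_sigma_piece F id n.
have CE : [set: {n & toronto_fin F n}] = \bigcup_n C n.
  exact: bigcup_range_existT.
split.
  by apply/(has_rank_omega_pieces CE TC) => m; exists m.+1.
move=> S; have [A [l [tA SE TA]]] := toronto_omega_subspace S.
move=> /(has_rank_omega_pieces SE TA) lm.
(* Keeping the first piece of each level makes the levels on [D] distinct. *)
pose D := [set d | forall i, l i = l d -> d <= i].
have lD m : exists d, D d /\ m < l d.
  have [i mi] := lm m.
  have ex : exists d, l d == l i by exists i.
  exists (ex_minn ex); case: ex_minnP => d /eqP ld dmin.
  by rewrite /D /= ld; split=> // j lj; apply: dmin; rewrite lj.
have l_inj : {in D &, injective l}.
  move=> c d /set_mem Dc /set_mem Dd lcd.
  by apply/eqP; rewrite eqn_leq Dc// Dd.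
have /choice[phi phiD] := lD.
have [i _|A' [tA' AE' TA']] :=
    toronto_piece_regroup (D := D) (phi := phi \o l) tA TA.
  have [Dp lp] := phiD (l i); split=> //=; move: lp.
  by case: (l (phi (l i))).
have [i _|C' [tC' CE' TC']] := toronto_piece_regroup (D := l @` D)
    (phi := l \o phi) (@trivIset_range_existT _ _) TC.
  have [Dp lp] := phiD i; split; first by exists (phi i).
  by move: lp => /=; case: (l (phi i)).
have SE' : [set: set_type S] = \bigcup_(d : set_type D) A' (set_val d).
  by rewrite -bigcup_set_type AE'.
have TE' : [set: {n & toronto_fin F n}] =
    \bigcup_(d : set_type D) C' (l (set_val d)).
  by rewrite -(bigcup_set_type D (C' \o l)) -(bigcup_image _ l C') CE'.
apply: open_homeomorphicT; rewrite SE' [X in open_homeomorphic X _]TE'.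
apply: open_homeomorphic_bigcup.
- move=> c d _ _ cd; apply: val_inj; apply: l_inj; rewrite ?inE;
    try exact: set_valP.
  by apply: tC' cd; eexists; try reflexivity; exact: set_valP.
- exact: trivIset_set_val.
- move=> d; apply: (@toronto_piece_unique F _ _ _ (l (set_val d))).
    by apply: TC'; exists (set_val d) => //; exact: set_valP.
  exact/TA'/set_valP.
Qed.

End sums_of_pieces.

Theorem theorem2p10 (F : pfilter_on nat) (homF : filter_homogeneous F)
    (isoF : filter_iso F (filter_times_omega F)) (n : upto_omega) :
  [/\ countable [set: toronto_space F n],
      toronto n (toronto_space F n) &
      forall (j : upto_omega) (S : set (toronto_space F n)),
        upto_omega_lt j n -> has_rank (set_type S) j ->
        exists I : countType,
          homeomorphic (set_type S) {i : I & toronto_space F j}].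
Proof.
split.
- case: n => [n|] /=.
    exact: toronto_piece_countable (toronto_fin_piece F n).
  rewrite bigcup_range_existT; apply: bigcup_countable => // n _.
  exact: toronto_piece_countable (toronto_sigma_piece F id n).
- case: n => [n|]; [exact: toronto_fin_toronto|exact: toronto_omega_toronto].
- case: n => [n|] [j|] //= S _ rS.
    have [A [l [tA SE TA _ _]]] := toronto_fin_subspace homF isoF S.
    exact (homeomorphic_pieces_fin homF isoF tA SE TA rS).
  have [A [l [tA SE TA]]] := toronto_omega_subspace homF isoF S.
  exact (homeomorphic_pieces_fin homF isoF tA SE TA rS).
Qed.
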